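(* Let $\Lambda\subset\mathbb{R}^n$ be a lattice with basis $B=\{\vec{v}_1,\ldots,\vec{v}_m\}$, where $m\le n$, and let $k$ be an integer with $1\le k\le n-1$. Then $\Lambda$ is $k$-cyclic with cyclicity factor $k$ if and only if $k$ is the smallest positive integer such that for every basis vector $\vec{v}_i\in B$, the $k$-th rotation $\rho^k(\vec{v}_i)$ belongs to $\Lambda$.
   Context: A lattice $\Lambda\subset\mathbb{R}^n$ is the set of all integer linear combinations of a finite family of $\mathbb{R}$-linearly independent vectors of $\mathbb{R}^n$ (a basis of $\Lambda$); it need not have full rank. The shift operator is the linear map $\rho:\mathbb{R}^n\to\mathbb{R}^n$, $\rho(c_1,\dots,c_n)=(c_n,c_1,\dots,c_{n-1})$, and $\rho^k$ is its $k$-fold iterate. For $1\le k\le n-1$, $\Lambda$ is called $k$-cyclic if $\rho^k(\Lambda)=\Lambda$ (the case $k=1$ is that of cyclic lattices; for $2\le k\le n-1$ the lattice is called quasi-cyclic). The cyclicity factor of $\Lambda$ is the smallest positive integer $k$ such that $\rho^k(\vec{x})\in\Lambda$ for every $\vec{x}\in\Lambda$. *)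

(* Defs.v *)
(* MathComp / MathComp-Analysis *)
From HB Require Import structures.
From mathcomp Require Import all_boot all_order all_algebra.
From mathcomp Require Import all_classical all_reals.

Set Implicit Arguments.
Unset Strict Implicit.
Unset Printing Implicit Defensive.

Import Order.TTheory GRing.Theory Num.Theory.

Local Open Scope classical_set_scope.
Local Open Scope ring_scope.

(* [free] (linear independence over R) also forces the entries of B to be
   pairwise distinct; m = 0 gives the zero lattice. *)
Definition lattice_basis (R : realType) (n m : nat)
    (B : m.-tuple 'rV[R]_n) (L : set 'rV[R]_n) : Prop :=
  free B /\ L = [set x | inIntSpan B x].

(* [ord_pred] is the cyclic predecessor on 'I_n, so that coordinate 0 of the
   result is the last coordinate of c. *)
Definition rho (R : realType) (n : nat) (c : 'rV[R]_n) : 'rV[R]_n :=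
  \row_(j < n) c 0 (ord_pred j).

Fact rho_is_linear (R : realType) (n : nat) : linear (@rho R n).
Proof. by move=> a u v; apply/rowP => j; rewrite !mxE. Qed.

HB.instance Definition _ (R : realType) (n : nat) :=
  GRing.isLinear.Build R 'rV[R]_n 'rV[R]_n *:%R (@rho R n) (@rho_is_linear R n).

(* Meant for 1 <= k <= n - 1. *)
Definition k_cyclic (R : realType) (n k : nat) (L : set 'rV[R]_n) : Prop :=
  iter k (@rho R n) @` L = L.

Definition smallest_positive (P : nat -> Prop) (k : nat) : Prop :=
  [/\ (0 < k)%N, P k & forall j : nat, (0 < j)%N -> P j -> (k <= j)%N].

Definition cyclicity_factor (R : realType) (n : nat) (L : set 'rV[R]_n)
    (k : nat) : Prop :=
  smallest_positive
    (fun j => forall x : 'rV[R]_n, L x -> L (iter j (@rho R n) x)) k.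

(* Main.v *)
(* Since rho^n = 1, the set rho^k(L) contains every x = rho^k (rho^((n-1)k) x)
   with x in L as soon as rho^k(L) is contained in L; and by linearity that
   inclusion can be tested on the generators. *)
Require Import Defs.
From HB Require Import structures.
From mathcomp Require Import all_boot all_order all_algebra.
From mathcomp Require Import all_classical all_reals.

Set Implicit Arguments.
Unset Strict Implicit.
Unset Printing Implicit Defensive.

Import GRing.Theory.

Local Open Scope classical_set_scope.
Local Open Scope ring_scope.

Lemma val_iter_ordS (n j : nat) (i : 'I_n) :
  iter j (@ordS n) i = ((i + j) %% n)%N :> nat.
Proof.
elim: j => [|j IHj] /=; first by rewrite addn0 modn_small.
by rewrite IHj -addn1 modnDml addn1 addnS.
Qed.

(** The computation is done for [ordS], whose iterates are plain addition modulo [n], and then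
    carried over to its inverse [ord_pred]. *)
Lemma iter_ord_pred_id (n : nat) (i : 'I_n) : iter n (@ord_pred n) i = i.
Proof.
have iter_ordS_id (l : 'I_n) : iter n (@ordS n) l = l.
  by apply: val_inj; rewrite /= val_iter_ordS modnDr modn_small.
have iterK j : cancel (iter j (@ordS n)) (iter j (@ord_pred n)).
  (* Peeling the innermost [ord_pred] and the outermost [ordS] makes the two meet and cancel. *)
  by elim: j => [//|j IHj] l; rewrite iterSr iterS ordSK IHj.
by rewrite -[in LHS](iter_ordS_id i) iterK.
Qed.

Lemma iter_rhoE (R : realType) (n j : nat) (x : 'rV[R]_n) (i : 'I_n) :
  iter j (@rho R n) x 0 i = x 0 (iter j (@ord_pred n) i).
Proof. by elim: j i => [//|j IHj] i; rewrite iterS mxE IHj iterSr. Qed.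

Lemma iter_rho_id (R : realType) (n : nat) (x : 'rV[R]_n) :
  iter n (@rho R n) x = x.
Proof. by apply/rowP => i; rewrite iter_rhoE iter_ord_pred_id. Qed.

Lemma iter_rho_muln_id (R : realType) (n j : nat) (x : 'rV[R]_n) :
  iter (j * n) (@rho R n) x = x.
Proof. by elim: j => [//|j IHj]; rewrite mulSn iterD IHj iter_rho_id. Qed.

Lemma k_cyclic_stable (R : realType) (n k : nat) (L : set 'rV[R]_n) :
  (0 < n)%N -> (forall x, L x -> L (iter k (@rho R n) x)) -> k_cyclic k L.
Proof.
move=> n_gt0 stabL; apply/seteqP; split=> [_ [x Lx <-]|x Lx]; first exact: stabL.
have stabLM j : L (iter (j * k) (@rho R n) x).
  by elim: j => [//|j IHj]; rewrite mulSn iterD; apply: stabL.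
exists (iter (n.-1 * k) (@rho R n) x) => //.
by rewrite -iterD -mulSn prednK // mulnC iter_rho_muln_id.
Qed.

(** Registered as an instance below, so that [iter j (@rho R n)] can serve as the additive map [f]
    of [inIntSpan_raddf]. *)
Fact iter_is_zmod_morphism (V : zmodType) (f : {additive V -> V}) (j : nat) :
  zmod_morphism (iter j f).
Proof. by elim: j => [//|j IHj] x y; rewrite !iterS IHj raddfB. Qed.

HB.instance Definition _ (V : zmodType) (f : {additive V -> V}) (j : nat) :=
  GRing.isZmodMorphism.Build V V (iter j f) (iter_is_zmod_morphism f j).

Lemma mem_inIntSpan (V : zmodType) (m : nat) (B : m.-tuple V) (v : V) :
  v \in B -> inIntSpan B v.
Proof.
case/(nthP 0) => i; rewrite size_tuple => lt_im <-.
(* The coefficients are the indicator of one position at which [v] occurs in [B]. *)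
exists [ffun l : 'I_m => (l == Ordinal lt_im)%:Z].
rewrite (bigD1 (Ordinal lt_im)) //= ffunE eqxx mulr1z big1 ?addr0 // => l ne_l.
by rewrite ffunE (negPf ne_l) mulr0z.
Qed.

Lemma inIntSpan0 (V : zmodType) (m : nat) (B : m.-tuple V) : inIntSpan B 0.
Proof. by exists 0; rewrite big1 // => i _; rewrite ffunE mulr0z. Qed.

Lemma inIntSpanD (V : zmodType) (m : nat) (B : m.-tuple V) (x y : V) :
  inIntSpan B x -> inIntSpan B y -> inIntSpan B (x + y).
Proof.
move=> [a ->] [b ->]; exists (a + b); rewrite -big_split /=.
by apply: eq_bigr => i _; rewrite ffunE mulrzDr.
Qed.

Lemma inIntSpanMz (V : zmodType) (m : nat) (B : m.-tuple V) (x : V) (c : int) :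
  inIntSpan B x -> inIntSpan B (x *~ c).
Proof.
move=> [a ->]; exists [ffun i => a i * c]; rewrite mulrz_suml.
by apply: eq_bigr => i _; rewrite ffunE mulrzA.
Qed.

(** An additive map commutes with sums and integer multiples, and the integer span is closed under
    both. *)
Lemma inIntSpan_raddf (V : zmodType) (m : nat) (B : m.-tuple V)
    (f : {additive V -> V}) :
  (forall v, v \in B -> inIntSpan B (f v)) ->
  forall x, inIntSpan B x -> inIntSpan B (f x).
Proof.
move=> fB _ [a ->]; rewrite raddf_sum; elim/big_ind: _ => [|x y|i _].
- exact: inIntSpan0.
- exact: inIntSpanD.
- by rewrite raddfMz; apply/inIntSpanMz/fB; rewrite mem_nth ?size_tuple.
Qed.

Theorem lemma5 (R : realType) (n m : nat) (L : set 'rV[R]_n)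
    (B : m.-tuple 'rV[R]_n) (k : nat)
    (hmn : (m <= n)%N) (hB : lattice_basis B L) (hk : (1 <= k <= n - 1)%N) :
  (k_cyclic k L /\ cyclicity_factor L k) <->
  smallest_positive
    (fun j => forall v : 'rV[R]_n, v \in B -> L (iter j (@rho R n) v)) k.
Proof.
(* For [n = 0] the truncated difference [n - 1] is 0, and [hk] would read [1 <= k <= 0]. *)
have n_gt0 : (0 < n)%N by case: n hk {L B hmn hB} => //; case: k.
(* The equivalence is stated for every exponent [j], not just for [k]: minimality compares [k] with
   all positive exponents, so it transfers in both directions. *)
have stableE j : (forall v, v \in B -> L (iter j (@rho R n) v)) <->
    (forall x, L x -> L (iter j (@rho R n) x)).
  case: hB => _ ->; split=> [|stabL v Bv]; last exact/stabL/mem_inIntSpan.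
  exact: (@inIntSpan_raddf _ _ B (iter j (@rho R n))).
split=> [[_ [k_gt0 stabL minL]]|[k_gt0 /stableE stabL minB]].
  by split=> // [|j j_gt0 /stableE]; [apply/stableE | apply: minL].
split; first exact: k_cyclic_stable.
by split=> // j j_gt0 /stableE; apply: minB.
Qed.
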